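(* Let $A\in\mathbb{C}_{n,n}$ with $\mathrm{Ind}(A)=k$. Then the WG inverse of $A$ satisfies $$A^{(W)}=\left(AA^{(\dag)}A\right)^{\#}=\left(A^{(\dag)}\right)^2A=\left(A^2\right)^{(\dag)}A .$$
   Context: $\mathbb{C}_{m,n}$ is the set of complex $m\times n$ matrices and $A^\ast$ the conjugate transpose. The index $\mathrm{Ind}(A)$ is the smallest positive integer $k$ with $\mathrm{rk}(A^{k+1})=\mathrm{rk}(A^k)$. For a matrix $M$ of index one, the group inverse $M^\#$ is the unique $X$ with $XM^2=M$, $XMX=X$, $MX=XM$. Core-EP decomposition (known): every $A\in\mathbb{C}_{n,n}$ with $\mathrm{Ind}(A)=k$ can be written uniquely as $A=A_1+A_2$ with $\mathrm{Ind}(A_1)=1$, $A_2^k=0$ and $A_1^\ast A_2=A_2A_1=0$, and there is a unitary $U$ with $A_1=U\begin{bmatrix}T&S\\0&0\end{bmatrix}U^\ast$, $A_2=U\begin{bmatrix}0&0\\0&N\end{bmatrix}U^\ast$, $T$ non-singular, $N$ nilpotent (blocks may be empty). The core-EP inverse of $A$ is $A^{(\dag)}=U\begin{bmatrix}T^{-1}&0\\0&0\end{bmatrix}U^\ast$ (independent of the choice of $U$). The WG (weak group) inverse $A^{(W)}$ of $A$ is the unique $X\in\mathbb{C}_{n,n}$ satisfying $AX^2=X$ and $AX=A^{(\dag)}A$. *)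

(* Defs.v *)
From HB Require Import structures.
From mathcomp Require Import all_boot all_order all_algebra.
From mathcomp Require Export spectral complex.
From mathcomp Require Export classical_sets reals.

Set Implicit Arguments.
Unset Strict Implicit.
Unset Printing Implicit Defensive.

Import Order.TTheory GRing.Theory Num.Theory.
Local Open Scope ring_scope.
Local Open Scope sesquilinear_scope.

Lemma index_subproof (F : fieldType) (n : nat) (A : 'M[F]_n) :
  exists k, (0 < k)%N && (\rank (A ^+ k.+1) == \rank (A ^+ k)).
Proof.
suff H m k : (\rank (A ^+ k.+1) <= m)%N ->
    exists j, (0 < j)%N && (\rank (A ^+ j.+1) == \rank (A ^+ j)).
  exact: (H n 0%N (rank_leq_row _)).
elim: m k => [|m IH] k.
  rewrite leqn0 => /eqP rk0; exists k.+1 => /=.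
  by rewrite rk0 -leqn0 -rk0 (exprS A k.+1) mxrankM_maxr.
move=> le_rk.
have [eq_rk|ne_rk] := eqVneq (\rank (A ^+ k.+2)) (\rank (A ^+ k.+1)).
  by exists k.+1; rewrite eq_rk eqxx.
apply: (IH k.+1); rewrite -ltnS (leq_trans _ le_rk) // ltn_neqAle ne_rk /=.
by rewrite (exprS A k.+1) mxrankM_maxr.
Qed.

(* The least *positive* k is taken, so nonsingular matrices have index 1. *)
Definition mxindex (F : fieldType) (n : nat) (A : 'M[F]_n) : nat :=
  ex_minn (index_subproof A).

Definition is_group_inverse (F : fieldType) (n : nat) (M X : 'M[F]_n) : Prop :=
  [/\ X *m M ^+ 2 = M, X *m M *m X = X & M *m X = X *m M].

(* Meaningful only if [mxindex M = 1]; otherwise no such X exists, and the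
   value is 0. *)
Definition group_inverse (F : fieldType) (n : nat) (M : 'M[F]_n) : 'M[F]_n :=
  xget 0 (is_group_inverse M).

Definition is_core_ep_decomposition (C : numClosedFieldType) (n : nat)
    (A A1 A2 : 'M[C]_n) : Prop :=
  [/\ A = A1 + A2, mxindex A1 = 1%N, A2 ^+ mxindex A = 0,
      A1 ^t* *m A2 = 0 & A2 *m A1 = 0].

(* The n x n matrix [P Q; P' Q'], blocks of sizes r and s (either may be 0). *)
Definition sq_block (V : nmodType) (n r s : nat) (rs_n : (r + s)%N = n)
    (P : 'M[V]_r) (Q : 'M[V]_(r, s)) (P' : 'M[V]_(s, r)) (Q' : 'M[V]_s) :
    'M[V]_n :=
  castmx (rs_n, rs_n) (block_mx P Q P' Q').

Definition is_core_ep_inverse (C : numClosedFieldType) (n : nat)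
    (A X : 'M[C]_n) : Prop :=
  exists (A1 A2 : 'M[C]_n) (r s : nat) (rs_n : (r + s)%N = n) (U : 'M[C]_n)
      (T : 'M[C]_r) (S : 'M[C]_(r, s)) (N : 'M[C]_s),
    [/\ is_core_ep_decomposition A A1 A2,
        [/\ U \is unitarymx, T \in unitmx & exists m : nat, N ^+ m = 0],
        A1 = U *m sq_block rs_n T S 0 0 *m U ^t*,
        A2 = U *m sq_block rs_n 0 0 0 N *m U ^t*
      & X = U *m sq_block rs_n (invmx T) 0 0 0 *m U ^t*].

Definition core_ep_inverse (C : numClosedFieldType) (n : nat) (A : 'M[C]_n) :
    'M[C]_n :=
  xget 0 (is_core_ep_inverse A).

Definition is_wg_inverse (C : numClosedFieldType) (n : nat)
    (A X : 'M[C]_n) : Prop :=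
  A *m X ^+ 2 = X /\ A *m X = core_ep_inverse A *m A.

Definition wg_inverse (C : numClosedFieldType) (n : nat) (A : 'M[C]_n) :
    'M[C]_n :=
  xget 0 (is_wg_inverse A).

(* Main.v *)
Require Import Defs.
From mathcomp Require Import all_boot all_order all_algebra.
From mathcomp Require Import complex reals.

Set Implicit Arguments.
Unset Strict Implicit.
Unset Printing Implicit Defensive.

Import Order.TTheory GRing.Theory Num.Theory.
Local Open Scope ring_scope.
Local Open Scope sesquilinear_scope.

(** Write X for the core-EP inverse of A and * for the conjugate transpose.
    Everything follows from three equations,
      X A^(m+1) = A^m for some m,   A X^2 = X,   (A X)^* = A X.
    The first two are purely ring-theoretic.  Iterating the second gives
    A^j X = A^m (A^j X^(m+1)), so X and A X lie in the right ideal A^m R of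
    the ring R, on which left multiplication by X A is the identity, by the
    first one.  Hence
    X A X = X and X A A X = A X, and with these cancellations
    - W = X^2 A satisfies A W = X A and A W^2 = W, and these two equations
      leave no other choice: W = (A W) W = X (A W) = X^2 A;
    - W commutes with M = A X A, both products being X A, and it is the group
      inverse of M, whence also the index of M is one;
    - X^2 satisfies the first two equations for A^2, and the third because
      A^2 X^2 = A X.

    The three equations have at most one solution: if X and Y are solutions,
    then A X and A Y absorb each other from the left, and as both are
    hermitian, A X = (A Y A X)^* = A X A Y = A Y, so that X = X A X = X A Y = Y.
    This makes the core-EP inverse of A^2 equal to X^2.

    It remains to see that the core-EP inverse, which is defined through a
    decomposition and a block form, exists and satisfies the three equations.
    With k the index of A, let the first columns of a unitary U span the range
    of A^k.  This range is stable under A, which makes U^* A U block triangular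
    with diagonal blocks T and N (lemma [core_ep_block_form]).  By the choice
    of k, the matrix A maps the range of A^k onto itself, so T is invertible;
    and the last rows of U^* A^k vanish, so N^k = 0.  Conversely, the first
    equation holds for a core-EP decomposition A = A1 + A2 because A2 A1 = 0
    gives A^k = A1 Z + A2^k = A1 Z for some Z, and X A is the identity on the
    range of A1. *)

(** * Ring identities for the equations X A^(m+1) = A^m and A X^2 = X *)

Section RingIdentities.
Variable R : pzRingType.
Implicit Types a g x y : R.

Lemma expr_mul_outer a g : a * g ^+ 2 = g -> forall m, a ^+ m * g ^+ m.+1 = g.
Proof.
move=> ag2; elim=> [|m IHm]; first by rewrite mul1r.
rewrite exprSr -mulrA 2!exprS (mulrA g) mulrA -expr2 -mulrA (mulrA a) ag2.
by rewrite -exprS.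
Qed.

(** The element a^j g equals a^m (a^j g^(m+1)), and x a is the identity on
    a^m R.  The elements x and g need not be related: this is what gives
    uniqueness of the core-EP inverse. *)
Lemma left_absorb a g x m j :
  x * a ^+ m.+1 = a ^+ m -> a * g ^+ 2 = g -> x * a * (a ^+ j * g) = a ^+ j * g.
Proof.
move=> xam ag2; rewrite -(expr_mul_outer ag2 m) (mulrA (a ^+ j)) -exprD.
by rewrite addnC exprD 2!mulrA -(mulrA x) -exprS -mulrA mulrA xam -mulrA.
Qed.

Lemma left_absorb0 a g x m :
  x * a ^+ m.+1 = a ^+ m -> a * g ^+ 2 = g -> x * a * g = g.
Proof. by move=> xam ag2; have := left_absorb 0 xam ag2; rewrite mul1r. Qed.

(** Since a2 a1 = 0, the only term in the expansion of (a1 + a2)^m that does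
    not start with a1 is a2^m. *)
Lemma split_nilpotent a1 a2 x m : a2 * a1 = 0 -> a2 ^+ m = 0 ->
  x * (a1 + a2) * a1 = a1 -> x * (a1 + a2) ^+ m.+1 = (a1 + a2) ^+ m.
Proof.
set a := a1 + a2 => a21 a2m xa1.
have [z am] : exists z, a ^+ m = a1 * z + a2 ^+ m.
  elim: m {a2m} => [|m [z am]]; first by exists 0; rewrite mulr0 add0r.
  exists (a ^+ m); rewrite !exprS {1}/a mulrDl; congr (_ + _).
  by rewrite am mulrDr mulrA a21 mul0r add0r.
by rewrite exprS mulrA am a2m addr0 mulrA xa1.
Qed.

Lemma group_inverse_uniq a x y : x * a ^+ 2 = a -> x * a * x = x ->
  a * x = x * a -> y * a ^+ 2 = a -> y * a * y = y -> a * y = y * a -> x = y.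
Proof.
move=> xa2 xax ax ya2 yay ay.
(* Both sides equal y a x a, because a x a = a. *)
have xya : x * a = y * a.
  by rewrite -ax -{1}ya2 expr2 -!mulrA ax (mulrA a) ax -mulrA -expr2 xa2.
by rewrite -xax xya -mulrA ax xya -ay mulrA yay.
Qed.

Section OuterInverse.
Variables (a g : R) (m : nat).
Hypothesis gam : g * a ^+ m.+1 = a ^+ m.
Hypothesis ag2 : a * g ^+ 2 = g.

Lemma outer_inverse : g * a * g = g.
Proof. exact: left_absorb0 gam ag2. Qed.

Let agg1 : a * g * g = g.
Proof. by rewrite -mulrA -expr2. Qed.

Let agg x : x * a * g * g = x * g.
Proof. by rewrite -!mulrA -expr2 ag2. Qed.

Lemma group_inverse_aga (b := a * g * a) (x := g ^+ 2 * a) :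
  [/\ x * b ^+ 2 = b, x * b * x = x & b * x = x * b].
Proof.
have bx : b * x = g * a by rewrite /b /x expr2 !mulrA agg agg1.
have gaag : g * a * (a * g) = a * g by exact: (left_absorb 1 gam ag2).
have xb : x * b = g * a.
  rewrite /x /b (_ : _ * _ = g * (g * a * (a * g)) * a); last first.
    by rewrite expr2 !mulrA.
  by rewrite gaag mulrA outer_inverse.
split; last by rewrite bx xb.
- by rewrite expr2 mulrA xb /b mulrA gaag.
- by rewrite xb /x expr2 !mulrA outer_inverse.
Qed.

(** These are the equations defining the weak group inverse, when g is the
    core-EP inverse of a. *)
Lemma weak_group_equations :
  a * (g ^+ 2 * a) ^+ 2 = g ^+ 2 * a /\ a * (g ^+ 2 * a) = g * a.
Proof.
have ax : a * (g ^+ 2 * a) = g * a by rewrite mulrA ag2.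
by split=> //; rewrite [X in a * X]expr2 mulrA ax expr2 !mulrA outer_inverse.
Qed.

Lemma sqr_left_equation : g ^+ 2 * (a ^+ 2) ^+ m.+1 = (a ^+ 2) ^+ m.
Proof.
(* The two factors g cancel one at a time, in g^2 a^(2m+2); the exponents met
   on the way are at least m. *)
have gaj j : g * a ^+ (m + j).+1 = a ^+ (m + j).
  by rewrite -addSn exprD mulrA gam -exprD.
rewrite -!exprM !mul2n doubleS -addnn -addnS expr2 -mulrA.
by rewrite gaj addnS gaj.
Qed.

Lemma sqr_range_equation : a ^+ 2 * (g ^+ 2) ^+ 2 = g ^+ 2.
Proof. by rewrite !expr2 !mulrA agg agg1. Qed.

End OuterInverse.

Lemma weak_group_uniq a g x :
  a * x ^+ 2 = x -> a * x = g * a -> x = g ^+ 2 * a.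
Proof.
by move=> ax2 ax; rewrite -{1}ax2 expr2 mulrA ax -mulrA ax mulrA -expr2.
Qed.

End RingIdentities.

(** * Index and group inverse of a matrix *)

(** The hypothesis bounds the rank of M by that of M^2. *)
Lemma mxindex1 (F : fieldType) (n : nat) (M X : 'M[F]_n) :
  X *m M ^+ 2 = M -> mxindex M = 1%N.
Proof.
move=> XM2; rewrite /mxindex; case: ex_minnP => j /andP[j_gt0 _] min_j.
apply/eqP; rewrite eqn_leq j_gt0 andbT; apply: min_j => /=.
by rewrite expr1 eqn_leq mxrankM_maxr -[X in (\rank X <= _)%N]XM2 mxrankM_maxr.
Qed.

Lemma mxindexP (F : fieldType) (n : nat) (A : 'M[F]_n) :
  \rank (A ^+ (mxindex A).+1) = \rank (A ^+ mxindex A).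
Proof. by rewrite /mxindex; case: ex_minnP => j /andP[_ /eqP]. Qed.

Lemma group_inverse_eq (F : fieldType) (n : nat) (M X : 'M[F]_n) :
  is_group_inverse M X -> group_inverse M = X.
Proof.
move=> MX; apply: xget_unique => // Y [YM2 YMY MY].
by case: MX => XM2 XMX MX; apply: group_inverse_uniq YM2 YMY MY XM2 XMX MX.
Qed.

Section CoreEP.
Variable C : numClosedFieldType.

(** * Unitary block triangularization *)

Lemma trmxC_mul m n p (P : 'M[C]_(m, n)) (Q : 'M[C]_(n, p)) :
  (P *m Q)^t* = Q^t* *m P^t*.
Proof. by rewrite trmx_mul map_mxM. Qed.

Lemma unitary_adj_mul n (U : 'M[C]_n) : U \is unitarymx -> U^t* *m U = 1%:M.
Proof. by move=> /unitarymxP/mulmx1C. Qed.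

Lemma unitary_conjM n (U P Q : 'M[C]_n) : U \is unitarymx ->
  U *m P *m U^t* *m (U *m Q *m U^t*) = U *m (P *m Q) *m U^t*.
Proof.
move=> /unitary_adj_mul UU.
by rewrite !mulmxA -(mulmxA (U *m P)) UU mulmx1.
Qed.

(** The columns of V^* form an orthonormal basis of the range of K followed by
    one of its orthogonal complement, the kernel of K^*.  The size of V is
    kept as r + s, a variable sum, so that n can be replaced by it. *)
Lemma unitary_adapted_basis m n (K : 'M[C]_(n, m)) :
  exists (r s : nat) (V : 'M[C]_(r + s, n)) (K1 : 'M[C]_(r, m)),
    [/\ r = \rank K, (r + s)%N = n, V \is unitarymx & V *m K = col_mx K1 0].
Proof.
(* Orthonormalization acts on rows, hence the adjoint. *)
pose W := K^t*.
exists (\rank W), _, (schmidt_complete W),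
  (schmidt (row_base W) *m K); split.
- by rewrite /W mxrank_map mxrank_tr.
- exact: add_rank_ortho.
- exact: schmidt_complete_unitarymx.
rewrite mul_col_mx; congr col_mx.
have -> : K = W^t* by rewrite trmxCK.
apply/orthomx1P.
by rewrite eqmx_schmidt_free ?row_base_free ?eq_row_base // orthomx_sym.
Qed.

(** The row matrix (0 1) intertwines a block triangular matrix with its lower
    diagonal block N, so it sends the k-th power to N^k (0 1). *)
Lemma block_triang_nilpotent r s (T : 'M[C]_r) (S : 'M[C]_(r, s)) (N : 'M[C]_s)
    (k : nat) (L : 'M[C]_(r, r + s)) :
  block_mx T S 0 N ^+ k = col_mx L 0 -> N ^+ k = 0.
Proof.
move=> Bk.
have iterN j : row_mx 0 1%:M *m block_mx T S 0 N ^+ j =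
    N ^+ j *m row_mx 0 1%:M :> 'M[C]_(s, r + s).
  elim: j => [|j IHj]; first by rewrite !expr0 mul1mx mulmx1.
  rewrite exprS -mulmxE mulmxA mul_row_block !mul0mx !mul1mx !add0r exprSr.
  have -> : row_mx 0 N = N *m row_mx 0 1%:M :> 'M[C]_(s, r + s).
    by rewrite mul_mx_row mulmx0 mulmx1.
  by rewrite -mulmxA IHj mulmxA mulmxE -exprS -exprSr.
move: (iterN k); rewrite Bk mul_row_col mul0mx mulmx0 addr0 => /esym.
by rewrite mul_mx_row mulmx0 mulmx1 -row_mx0 => /eq_row_mx[].
Qed.

(** The unitary U is adapted to the range of A^k, where k is the index of A:
    stability of this range under A is the zero block, and T, the restriction
    of A to it, is onto. *)
Lemma core_ep_block_form n (A : 'M[C]_n) :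
  exists (r s : nat) (rs_n : (r + s)%N = n) (U : 'M[C]_n)
      (T : 'M[C]_r) (S : 'M[C]_(r, s)) (N : 'M[C]_s),
    [/\ U \is unitarymx, T \in unitmx, N ^+ mxindex A = 0
      & A = U *m sq_block rs_n T S 0 N *m U^t*].
Proof.
set k := mxindex A.
have [r [s [V [K1 [r_rank rs_n V_unitary VK]]]]] :=
  unitary_adapted_basis (A ^+ k).
exists r, s, rs_n; case: n / rs_n => /= in A k V K1 r_rank V_unitary VK *.
have VV : V^t* *m V = 1%:M by exact: unitary_adj_mul.
pose B := V *m A *m V^t*.
have VA : V *m A = B *m V by rewrite /B -!mulmxA VV mulmx1.
have rankV j : \rank (V *m A ^+ j) = \rank (A ^+ j).
  by rewrite eqmxMfull // row_full_unit unitarymx_unit.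
have rK1 : \rank K1 = r.
  by rewrite [RHS]r_rank -rankV VK -addsmxE addsmx0.
have K1_free : row_free K1 by rewrite /row_free rK1.
pose T := ulsubmx B; pose S := ursubmx B.
pose Z := dlsubmx B; pose N := drsubmx B.
have BE : B = block_mx T S Z N by rewrite submxK.
(* V A^(k+1) is computed in two ways, as (V A) A^k and as (V A^k) A; the latter
   has zero last rows, which gives Z = 0 as the rows of K1 are independent. *)
have VAK : V *m A ^+ k.+1 = col_mx (T *m K1) (Z *m K1).
  rewrite exprS -mulmxE mulmxA VA -mulmxA VK BE mul_block_col.
  by rewrite !mulmx0 !addr0.
have Z0 : Z = 0.
  apply: (row_free_inj K1_free); rewrite mul0mx.
  move: VAK; rewrite exprSr -mulmxE mulmxA VK mul_col_mx mul0mx.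
  by case/eq_col_mx.
have T_unit : T \in unitmx.
  (* A^k and A^(k+1) have the same rank r, which is thus the rank of T K1. *)
  rewrite -row_free_unit /row_free eqn_leq rank_leq_row /=.
  rewrite [X in (X <= _)%N]r_rank -mxindexP -/k -rankV VAK Z0 mul0mx.
  by rewrite -addsmxE addsmx0 mxrankM_maxl.
exists (V^t*), T, S, N.
rewrite trmxC_unitary trmxCK /sq_block castmx_id -Z0 -BE.
split=> //; last by rewrite /B !mulmxA VV mul1mx -mulmxA VV mulmx1.
apply: (@block_triang_nilpotent _ _ T S _ _ (K1 *m V^t*)).
have <- : V *m A ^+ k *m V^t* = col_mx (K1 *m V^t*) 0.
  by rewrite VK mul_col_mx mul0mx.
rewrite -Z0 -BE.
elim: k {VK VAK r_rank} => [|j IHj].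
  by rewrite !expr0 mulmx1 (unitarymxP _).
rewrite !exprSr -mulmxE IHj /B !mulmxA.
by rewrite -(mulmxA (V *m A ^+ j)) VV mulmx1.
Qed.

(** * The equations characterizing the core-EP inverse *)

(** The exponent m is left free, so that the equations for A^2 can be deduced
    from those for A without computing the index of A^2. *)
Definition core_ep_equations n (A X : 'M[C]_n) : Prop :=
  [/\ exists m, X * A ^+ m.+1 = A ^+ m, A * X ^+ 2 = X
    & (A *m X)^t* = A *m X].

(** A X and A Y are hermitian and absorb each other from the left. *)
Lemma core_ep_equations_uniq n (A X Y : 'M[C]_n) :
  core_ep_equations A X -> core_ep_equations A Y -> X = Y.
Proof.
move=> [[m XA] AX2 AXh] [[p YA] AY2 AYh].
have AXY : A *m X = A *m Y.
  have AYX : A *m Y *m (A *m X) = A *m X.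
    by rewrite -mulmxA (mulmxA Y) !mulmxE (left_absorb0 YA AX2).
  have AXY : A *m X *m (A *m Y) = A *m Y.
    by rewrite -mulmxA (mulmxA X) !mulmxE (left_absorb0 XA AY2).
  by rewrite -AXh -AYX trmxC_mul AXh AYh AXY.
rewrite -(left_absorb0 XA AX2) -[RHS](left_absorb0 XA AY2) -!mulrA.
by congr (X * _); exact: AXY.
Qed.

Lemma block_core_inverse r s (T : 'M[C]_r) (S : 'M[C]_(r, s))
    (M := block_mx T S 0 0) (Y := block_mx (invmx T) 0 0 0) :
  T \in unitmx ->
  [/\ M *m Y = block_mx 1%:M 0 0 0, M *m Y *m Y = Y & Y *m M *m M = M].
Proof.
move=> T_unit; have MY : M *m Y = block_mx 1%:M 0 0 0.
  by rewrite mulmx_block !mulmx0 !mul0mx !addr0 mulmxV.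
split=> //; first by rewrite MY mulmx_block !mulmx0 !mul0mx !addr0 mul1mx.
rewrite !mulmx_block !mulmx0 !mul0mx !addr0 mulVmx //.
by rewrite !mul1mx !mul0mx.
Qed.

(** As A2 X = X A2 = 0, the products A X and X A are those of A1 with X. *)
Lemma core_ep_inverse_equations n (A X : 'M[C]_n) :
  is_core_ep_inverse A X -> core_ep_equations A X.
Proof.
case=> A1 [A2 [r [s [rs_n [U [T [S [N []]]]]]]]].
case: n / rs_n => /= in A X A1 A2 U *.
rewrite /sq_block !castmx_id.
move=> [AE _ A2k _ A21] [U_unitary T_unit _] A1E A2E XE.
have [MY MYY YMM] := block_core_inverse S T_unit.
have A2X : A2 *m X = 0.
  rewrite A2E XE unitary_conjM // mulmx_block !mulmx0 !mul0mx !addr0 block_mx0.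
  by rewrite mulmx0 mul0mx.
have XA2 : X *m A2 = 0.
  rewrite A2E XE unitary_conjM // mulmx_block !mulmx0 !mul0mx !addr0 block_mx0.
  by rewrite mulmx0 mul0mx.
have AX : A *m X = U *m block_mx 1%:M 0 0 0 *m U^t*.
  by rewrite AE mulmxDl A2X addr0 A1E XE unitary_conjM // MY.
split.
- exists (mxindex A); rewrite {1 3}AE; apply: split_nilpotent => //.
  rewrite mulrDr [X * A2]XA2 addr0 A1E XE -!mulmxE !unitary_conjM //.
  by rewrite YMM.
- rewrite expr2 mulrA -!mulmxE AX [X in _ *m X]XE unitary_conjM // -MY MYY.
  by rewrite -XE.
- rewrite AX !trmxC_mul trmxCK tr_block_mx map_block_mx.
  by rewrite trmx1 map_mx1 !trmx0 !map_mx0 mulmxA.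
Qed.

Lemma core_ep_inverse_exists n (A : 'M[C]_n) :
  exists X, is_core_ep_inverse A X.
Proof.
have [r [s [rs_n [U [T [S [N [U_unitary T_unit Nk AE]]]]]]]] :=
  core_ep_block_form A.
case: n / rs_n => /= in A U U_unitary Nk AE *.
have [MY MYY YMM] := block_core_inverse S T_unit.
pose A1 := U *m block_mx T S 0 0 *m U^t*.
pose A2 := U *m block_mx 0 0 0 N *m U^t*.
pose X := U *m block_mx (invmx T) 0 0 0 *m U^t*.
exists X, A1, A2, r, s, erefl, U, T, S, N.
rewrite /sq_block !castmx_id in AE *; split=> //; last first.
  by split=> //; exists (mxindex A).
split.
- by rewrite AE /A1 /A2 -mulmxDl -mulmxDr add_block_mx !addr0 !add0r.
- apply: (@mxindex1 _ _ _ X).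
  by rewrite expr2 -mulmxE mulmxA !unitary_conjM // YMM.
- (* The zeroth power is the identity, which has not this form: hence j + 1. *)
  have A2j j : A2 ^+ j.+1 = U *m block_mx 0 0 0 (N ^+ j.+1) *m U^t*.
    elim: j => [|j IHj]; first by rewrite !expr1.
    rewrite exprS IHj -mulmxE unitary_conjM // mulmx_block.
    by rewrite !mulmx0 !mul0mx !add0r (exprS N j.+1).
  have k_gt0 : (0 < mxindex A)%N.
    by rewrite /mxindex; case: ex_minnP => ? /andP[].
  by rewrite -(prednK k_gt0) A2j prednK // Nk block_mx0 mulmx0 mul0mx.
- rewrite /A1 !trmxC_mul trmxCK mulmxA unitary_conjM //.
  rewrite tr_block_mx map_block_mx !trmx0 !map_mx0 mulmx_block.
  by rewrite !mulmx0 !mul0mx !addr0 block_mx0 mulmx0 mul0mx.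
- rewrite unitary_conjM // mulmx_block.
  by rewrite !mulmx0 !mul0mx !addr0 block_mx0 mulmx0 mul0mx.
Qed.

Lemma core_ep_inverseP n (A : 'M[C]_n) :
  core_ep_equations A (core_ep_inverse A).
Proof.
apply: core_ep_inverse_equations.
exact: (xgetPex (P := is_core_ep_inverse A) 0 (core_ep_inverse_exists A)).
Qed.

(** * The core-EP inverse of a square and the weak group inverse *)

Lemma core_ep_inverse_sqr n (A : 'M[C]_n) :
  core_ep_inverse (A ^+ 2) = core_ep_inverse A ^+ 2.
Proof.
apply: core_ep_equations_uniq (core_ep_inverseP _) _.
have [[m XA] AX2 AXh] := core_ep_inverseP A; split.
- by exists m; apply: sqr_left_equation.
- exact: sqr_range_equation.
- rewrite [_ *m _](_ : _ = A *m core_ep_inverse A) //.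
  by rewrite expr2 -mulmxE -mulmxA mulmxE AX2.
Qed.

Lemma wg_inverseE n (A : 'M[C]_n) : wg_inverse A = core_ep_inverse A ^+ 2 *m A.
Proof.
have [[m XA] AX2 _] := core_ep_inverseP A.
apply: xget_unique; first exact: weak_group_equations XA AX2.
by move=> X [AXX AX]; apply: weak_group_uniq.
Qed.

End CoreEP.

Theorem theorem3p3 (R : realType) (n k : nat) (A : 'M[R[i]]_n)
    (hk : mxindex A = k) :
  [/\ mxindex (A *m core_ep_inverse A *m A) = 1%N,
      wg_inverse A = group_inverse (A *m core_ep_inverse A *m A),
      wg_inverse A = (core_ep_inverse A) ^+ 2 *m A
    & wg_inverse A = core_ep_inverse (A ^+ 2) *m A].
Proof.
have [[m XA] AX2 _] := core_ep_inverseP A.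
have AXA := group_inverse_aga XA AX2.
rewrite core_ep_inverse_sqr wg_inverseE (group_inverse_eq AXA).
by split=> //; case: AXA => /mxindex1.
Qed.
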